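(* Let $B\in\mathbb{R}$ be sufficiently large (i.e., there is a constant $B_0$, depending on the data $M,\bar q,\bar u,h$, such that the following holds for every $B\ge B_0$), and consider the mixed-integer feasibility problem of finding $x\in\{0,1\}^n$, $r\in\mathbb{R}^n$, $A,C,D\in\mathbb{R}^{n\times n}$ such that \begin{align*} & Bx_i\ge r_i\ge 0, && i\in[n],\\ & B(1-x_i)\ge M_{i,\cdot}r+\bar q_i\ge 0, && i\in[n],\\ & D_{[h],\cdot}=0,\quad D_{\cdot,S}=0,\\ & B(1-x_i)\ge M_{i,\cdot}D_{\cdot,j}\ge -B(1-x_i), && i\in S,\ j\in U,\\ & B(1-x_j)-1\ge M_{j,\cdot}D_{\cdot,j}\ge -B(1-x_j)-1, && j\in U,\\ & B(1-x_i)\ge M_{i,\cdot}D_{\cdot,j}\ge -B(1-x_i), && i,j\in U,\ i\ne j,\\ & A_{i,j}\le -D_{i,j}\bar u_j, && i\in[n],\ j\in U,\\ & A_{i,j}\le D_{i,j}\bar u_j, && i\in[n],\ j\in U,\\ & \sum_{j\in U}A_{i,j}+r_i\ge 0, && i\in[n],\\ & C_{i,j}\le -(M_{i,\cdot}D_{\cdot,j}+\delta_{ij})\bar u_j, && i\in[n],\ j\in U,\\ & C_{i,j}\le (M_{i,\cdot}D_{\cdot,j}+\delta_{ij})\bar u_j, && i\in[n],\ j\in U,\\ & \sum_{j\in U}C_{i,j}+M_{i,\cdot}r+\bar q_i\ge 0, && i\in[n]. \end{align*} If this problem is feasible, then it returns an AAR solution of the uncertain LCP $$0\le z(u)\perp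 Mz(u)+q(u)\ge 0\quad\text{for all } u\in\mathcal{U},$$ of the form $z(u)=Du+r$ (that is, for every feasible point $(x,r,A,C,D)$, the function $z(u)=Du+r$ is an AAR solution). If it is infeasible, then no AAR solution exists.
   Context: Notation: $[n]=\{1,\dots,n\}$ and $[h]=\{1,\dots,h\}$ ($[0]=\emptyset$). For a matrix $A$ and index sets $I,J$, $A_{I,J}$ is the submatrix with rows in $I$ and columns in $J$, $A_I=A_{I,I}$, $A_{i,\cdot}$ is the $i$-th row and $A_{\cdot,j}$ the $j$-th column; $b_I$ is the subvector of $b$ indexed by $I$; $\delta_{ij}$ is the Kronecker delta. Vector inequalities are componentwise, and $0\le a\perp b\ge 0$ means $a\ge0$, $b\ge0$, $a^\top b=0$. Data: $M\in\mathbb{R}^{n\times n}$, $\bar q\in\mathbb{R}^n$, $\bar u\in\mathbb{R}^n_{\ge0}$, $h\in\{0,\dots,n\}$. The uncertainty set is the box $\mathcal{U}=\{u\in\mathbb{R}^n: -\bar u_i\le u_i\le \bar u_i,\ i\in[n]\}$, and $q(u)=\bar q+u$ for $u\in\mathcal{U}$. Let $U=\{i\in[n]:\bar u_i>0\}$ and $S=\{i\in[n]:\bar u_i=0\}$. An affinely adjustable robust (AAR) solution of the uncertain LCP is an affine function $z(u)=Du+r$ with $D\in\mathbb{R}^{n\times n}$, $r\in\mathbb{R}^n$, $D_{[h],\cdot}=0$ (the first $h$ variables are non-adjustable) and, by convention, $D_{\cdot,S}=0$, such that $0\le z(u)\perp Mz(u)+q(u)\ge0$ for all $u\in\mathcal{U}$.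 *)

(* Defs.v *)
From mathcomp Require Import all_boot all_order all_algebra.
From mathcomp Require Import reals.

Set Implicit Arguments.
Unset Strict Implicit.
Unset Printing Implicit Defensive.

Import Order.TTheory GRing.Theory Num.Theory.
Local Open Scope ring_scope.

Definition nonneg_vec (R : realType) (n : nat) (a : 'cV[R]_n) : Prop :=
  forall i, 0 <= a i 0.

(* 0 <= a _|_ b >= 0 *)
Definition complementary (R : realType) (n : nat) (a b : 'cV[R]_n) : Prop :=
  [/\ nonneg_vec a, nonneg_vec b & a^T *m b = 0].

Definition uncertainty_box (R : realType) (n : nat) (ubar u : 'cV[R]_n) : Prop :=
  forall i, - ubar i 0 <= u i 0 <= ubar i 0.

Definition idxU (R : realType) (n : nat) (ubar : 'cV[R]_n) : {set 'I_n} :=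
  [set i | 0 < ubar i 0].

Definition idxS (R : realType) (n : nat) (ubar : 'cV[R]_n) : {set 'I_n} :=
  [set i | ubar i 0 == 0].

(* D_{[h],.} = 0 and D_{.,S} = 0. Indices in 'I_n start at 0, so the index
   set {1,...,h} corresponds to the i : 'I_n with i < h. *)
Definition admissible_slope (R : realType) (n : nat) (ubar : 'cV[R]_n) (h : nat)
    (D : 'M[R]_n) : Prop :=
  (forall i j : 'I_n, (i < h)%N -> D i j = 0) /\
  (forall i j : 'I_n, j \in idxS ubar -> D i j = 0).

Definition AAR_solution (R : realType) (n : nat) (M : 'M[R]_n)
    (qbar ubar : 'cV[R]_n) (h : nat) (z : 'cV[R]_n -> 'cV[R]_n) : Prop :=
  exists (D : 'M[R]_n) (r : 'cV[R]_n),
    [/\ forall u, z u = D *m u + r,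
        admissible_slope ubar h D
      & forall u, uncertainty_box ubar u ->
          complementary (z u) (M *m z u + (qbar + u))].

(* M_{i,.} r and M_{i,.} D_{.,j} are the entries (M *m r) i 0 and
   (M *m D) i j; the Kronecker delta is (i == j)%:R, and a 0/1 variable is a
   boolean entry, used through its numeral (x i 0)%:R. *)
Record MIP_feasible (R : realType) (n : nat) (M : 'M[R]_n)
    (qbar ubar : 'cV[R]_n) (h : nat) (B : R)
    (x : 'cV[bool]_n) (r : 'cV[R]_n) (A C D : 'M[R]_n) : Prop := {
  mip_r : forall i, 0 <= r i 0 <= B * (x i 0)%:R;
  mip_w : forall i, 0 <= (M *m r) i 0 + qbar i 0 <= B * (1 - (x i 0)%:R);
  mip_slope : admissible_slope ubar h D;
  mip_SU : forall i j, i \in idxS ubar -> j \in idxU ubar ->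
    - (B * (1 - (x i 0)%:R)) <= (M *m D) i j <= B * (1 - (x i 0)%:R);
  mip_diag : forall j, j \in idxU ubar ->
    - (B * (1 - (x j 0)%:R)) - 1 <= (M *m D) j j <= B * (1 - (x j 0)%:R) - 1;
  mip_UU : forall i j, i \in idxU ubar -> j \in idxU ubar -> i != j ->
    - (B * (1 - (x i 0)%:R)) <= (M *m D) i j <= B * (1 - (x i 0)%:R);
  mip_A_neg : forall i j, j \in idxU ubar -> A i j <= - D i j * ubar j 0;
  mip_A_pos : forall i j, j \in idxU ubar -> A i j <= D i j * ubar j 0;
  mip_A_sum : forall i, 0 <= (\sum_(j in idxU ubar) A i j) + r i 0;
  mip_C_neg : forall i j, j \in idxU ubar ->
    C i j <= - ((M *m D) i j + (i == j)%:R) * ubar j 0;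
  mip_C_pos : forall i j, j \in idxU ubar ->
    C i j <= ((M *m D) i j + (i == j)%:R) * ubar j 0;
  mip_C_sum : forall i,
    0 <= (\sum_(j in idxU ubar) C i j) + ((M *m r) i 0 + qbar i 0)
}.

(* Main.v *)
(** An affine function [c + \sum_j a_j u_j] is nonnegative on the box exactly
    when [\sum_j |a_j| ubar_j <= c], its worst case being at a vertex; the
    variables [A] and [C] linearise these absolute values.  If it is nonnegative
    on the box and vanishes at the centre ([c = 0]), all [a_j] with
    [ubar_j > 0] vanish.  Hence, for an AAR solution, complementarity at the
    single point [u = 0] already decides for every [i] which of the two affine
    functions [z_i], [(M z + q)_i] is identically zero, and [x_i] records this
    choice. The constant [B0] only has to dominate the entries of one AAR
    solution, if there is any; a feasible point yields an AAR solution for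
    every [B]. *)
Require Import Defs.
From mathcomp Require Import all_boot all_order all_algebra.
From mathcomp Require Import boolp reals lra.

Set Implicit Arguments.
Unset Strict Implicit.
Unset Printing Implicit Defensive.

Import Order.TTheory GRing.Theory Num.Theory.
Local Open Scope ring_scope.

(** * Affine functions on the uncertainty box *)

Section Box.
Variables (R : realType) (n : nat) (ubar : 'cV[R]_n).
Hypothesis ubar_ge0 : nonneg_vec ubar.
Implicit Types (a : 'I_n -> R) (c : R) (u : 'cV[R]_n) (F : 'I_n -> R).

Lemma norm_box u j : uncertainty_box ubar u -> `|u j 0| <= ubar j 0.
Proof. by move=> /(_ j); rewrite ler_norml. Qed.

Lemma box0 : uncertainty_box ubar 0.
Proof. by move=> j; rewrite mxE oppr_le0 ubar_ge0. Qed.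

Lemma notin_idxU j : j \notin idxU ubar -> ubar j 0 = 0.
Proof.
by rewrite inE -leNgt => uj; apply/eqP; rewrite eq_le uj ubar_ge0.
Qed.

Lemma sum_idxU F : (forall j, ubar j 0 = 0 -> F j = 0) ->
  \sum_(j in idxU ubar) F j = \sum_j F j.
Proof.
move=> F0; rewrite [RHS](bigID (mem (idxU ubar))) /= [X in _ + X]big1 ?addr0 //.
by move=> j /notin_idxU /F0.
Qed.

Lemma affine_box_ge0 a c :
  (forall u, uncertainty_box ubar u -> 0 <= \sum_j a j * u j 0 + c) <->
  0 <= c - \sum_j `|a j| * ubar j 0.
Proof.
split=> [H | H u bu].
  (* The minimiser: each coordinate is pushed against the sign of [a j], so it contributes
     [- |a j| * ubar j 0]. Where [a j = 0] the sign is 0 and the coordinate stays at the centre. *)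
  pose v : 'cV[R]_n := \col_j - (Num.sg (a j) * ubar j 0).
  have bv : uncertainty_box ubar v.
    move=> j; rewrite mxE -ler_norml normrN normrM (ger0_norm (ubar_ge0 j)).
    by rewrite ler_piMl ?ubar_ge0 // normr_sg; case: (a j != 0).
  have := H v bv; rewrite addrC -sumrN.
  congr (0 <= _ + _); apply: eq_bigr => j _.
  by rewrite mxE mulrN mulrA (mulrC (a j)) -normrEsg.
apply: le_trans H _; rewrite addrC lerD2r -sumrN; apply: ler_sum => j _.
have : `|a j * u j 0| <= `|a j| * ubar j 0.
  by rewrite normrM ler_wpM2l ?norm_box.
by rewrite ler_norml => /andP[].
Qed.

Lemma affine_box_ge0_center0 a :
  0 <= - \sum_j `|a j| * ubar j 0 -> forall j, j \in idxU ubar -> a j = 0.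
Proof.
move=> H j; rewrite inE => uj.
have F0 k : true -> 0 <= `|a k| * ubar k 0 by rewrite mulr_ge0 ?ubar_ge0.
have : \sum_k `|a k| * ubar k 0 == 0 by rewrite eq_le -oppr_ge0 H sumr_ge0.
rewrite psumr_eq0 // => /allP /(_ j (mem_index_enum _)) /=.
by rewrite mulf_eq0 normr_eq0 (gt_eqF uj) orbF => /eqP.
Qed.

Lemma affine_box_eq0 a u : uncertainty_box ubar u ->
  (forall j, j \in idxU ubar -> a j = 0) -> \sum_j a j * u j 0 = 0.
Proof.
move=> bu a0; apply: big1 => j _.
have [/a0 -> | /notin_idxU uj] := boolP (j \in idxU ubar); first exact: mul0r.
by have := norm_box j bu; rewrite uj normr_le0 => /eqP ->; rewrite mulr0.
Qed.

(** Lying below both [a j * ubar j 0] and its opposite means lying below [- |a j| * ubar j 0].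
    Indices outside [idxU] add nothing, since there [ubar] is 0. *)
Lemma linearized_norms a c F :
  (forall j, j \in idxU ubar -> F j <= - a j * ubar j 0) ->
  (forall j, j \in idxU ubar -> F j <= a j * ubar j 0) ->
  0 <= \sum_(j in idxU ubar) F j + c -> 0 <= c - \sum_j `|a j| * ubar j 0.
Proof.
move=> Fn Fp /le_trans; apply; rewrite addrC lerD2l.
rewrite -(@sum_idxU (fun j => `|a j| * _)); last by move=> j ->; rewrite mulr0.
rewrite -sumrN; apply: ler_sum => j jU; rewrite -mulNr.
by case: (ger0P (a j)) => _; [exact: Fn | rewrite opprK; exact: Fp].
Qed.

Lemma sum_neg_norms a c : 0 <= c - \sum_j `|a j| * ubar j 0 ->
  0 <= \sum_(j in idxU ubar) - `|a j| * ubar j 0 + c.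
Proof.
rewrite sum_idxU => [|j ->]; last by rewrite mulr0.
by rewrite addrC -sumrN; under eq_bigr do rewrite -mulNr.
Qed.

Lemma neg_norm_leN (x : R) j : - `|x| * ubar j 0 <= - x * ubar j 0.
Proof. by rewrite ler_wpM2r ?ubar_ge0 // lerN2 ler_norm. Qed.

Lemma neg_norm_le (x : R) j : - `|x| * ubar j 0 <= x * ubar j 0.
Proof. by rewrite ler_wpM2r ?ubar_ge0 // lerNl -normrN ler_norm. Qed.

End Box.

Lemma dotmx_ge0_eq0 (R : realType) (n : nat) (a b : 'cV[R]_n) :
  nonneg_vec a -> nonneg_vec b ->
  (a^T *m b = 0) <-> (forall i, a i 0 * b i 0 = 0).
Proof.
move=> a0 b0; split=> [/matrixP /(_ 0 0) | H].
  rewrite !mxE => /eqP; rewrite psumr_eq0 => [/allP H i | i _].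
    by have := H i (mem_index_enum _); rewrite /= mxE => /eqP.
  by rewrite mxE mulr_ge0.
apply/matrixP => i j; rewrite !mxE (ord1 j) big1 // => k _.
by rewrite mxE (ord1 i) H.
Qed.

(** * Robust solutions and feasible points of the mixed-integer problem *)

Section LCP.
Variables (R : realType) (n : nat) (M : 'M[R]_n) (qbar ubar : 'cV[R]_n).
Variable h : nat.
Hypothesis ubar_ge0 : nonneg_vec ubar.
Implicit Types (r u : 'cV[R]_n) (D : 'M[R]_n).

Definition slack_slope D (i j : 'I_n) : R := (M *m D) i j + (i == j)%:R.
Definition slack_center r (i : 'I_n) : R := (M *m r) i 0 + qbar i 0.

Lemma affine_entry D r u i :
  (D *m u + r) i 0 = \sum_j D i j * u j 0 + r i 0.
Proof. by rewrite !mxE. Qed.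

Lemma slack_entry D r u i : (M *m (D *m u + r) + (qbar + u)) i 0 =
  \sum_j slack_slope D i j * u j 0 + slack_center r i.
Proof.
have -> : M *m (D *m u + r) + (qbar + u) = (M *m D + 1%:M) *m u + (M *m r + qbar).
  by rewrite mulmxDr mulmxDl mul1mx mulmxA [qbar + u]addrC addrACA.
rewrite affine_entry; congr (_ + _); last by rewrite mxE.
by apply: eq_bigr => j _; rewrite [in LHS]mxE [(1%:M) _ _]mxE.
Qed.

(** The robust LCP with the quantifier over [u] eliminated: two worst-case inequalities, and
    complementarity at the centre of the box. *)
Definition robust_pair D r :=
  forall i, [/\ 0 <= r i 0 - \sum_j `|D i j| * ubar j 0,
    0 <= slack_center r i - \sum_j `|slack_slope D i j| * ubar j 0
  & r i 0 = 0 \/ slack_center r i = 0].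

Lemma robust_complementary D r :
  (forall u, uncertainty_box ubar u ->
     complementary (D *m u + r) (M *m (D *m u + r) + (qbar + u)))
  <-> robust_pair D r.
Proof.
split=> [H i | H u bu].
  split.
  - apply/(affine_box_ge0 ubar_ge0) => u /H[z0 _ _].
    by rewrite -affine_entry.
  - apply/(affine_box_ge0 ubar_ge0) => u /H[_ w0 _].
    by rewrite -slack_entry.
  have [z0 w0 /(dotmx_ge0_eq0 z0 w0)/(_ i)/eqP] := H 0 (box0 ubar_ge0).
  rewrite mulf_eq0 slack_entry affine_entry.
  rewrite !big1 ?add0r; first by case/orP => /eqP; [left | right].
    by move=> j _; rewrite mxE mulr0.
  by move=> j _; rewrite mxE mulr0.
have z0 : nonneg_vec (D *m u + r).
  move=> i; have [/(affine_box_ge0 ubar_ge0) /(_ _ bu) Hi _ _] := H i.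
  by rewrite affine_entry.
have w0 : nonneg_vec (M *m (D *m u + r) + (qbar + u)).
  move=> i; have [_ /(affine_box_ge0 ubar_ge0) /(_ _ bu) Hi _] := H i.
  by rewrite slack_entry.
split=> //; apply/(dotmx_ge0_eq0 z0 w0) => i.
rewrite affine_entry slack_entry.
(* The factor that is 0 at the centre is nonnegative on the box, so its slopes over [idxU] vanish
   and it is 0 at every [u]. *)
have [Hz Hw [r0 | c0]] := H i.
  move: Hz; rewrite r0 sub0r => /(affine_box_ge0_center0 ubar_ge0) Hz.
  by rewrite (affine_box_eq0 ubar_ge0 bu Hz) addr0 mul0r.
move: Hw; rewrite c0 sub0r => /(affine_box_ge0_center0 ubar_ge0) Hw.
by rewrite (affine_box_eq0 ubar_ge0 bu Hw) addr0 mulr0.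
Qed.

(** For either value of [x i 0], one of the two big-M upper bounds is 0 whatever [B] is; this gives
    the disjunction. *)
Lemma MIP_feasible_robust_pair B (x : 'cV[bool]_n) r (A C D : 'M[R]_n) :
  MIP_feasible M qbar ubar h B x r A C D -> robust_pair D r.
Proof.
move=> [Hr Hw _ _ _ _ An Ap As Cn Cp Cs] i; split.
- exact: (linearized_norms ubar_ge0 (An i) (Ap i) (As i)).
- exact: (linearized_norms ubar_ge0 (Cn i) (Cp i) (Cs i)).
move: (Hr i) (Hw i); rewrite -/(slack_center r i); case: (x i 0) => /=.
  by rewrite subrr mulr0 => _ /le_anti; right.
by rewrite mulr0 => /le_anti; left.
Qed.

(** Taking [x i 0] true exactly when [r i 0 != 0] makes the tight constraints hold; [B] only has to
    satisfy the slack ones. The summand 1 in its bound absorbs the [- 1] of the diagonal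
    constraints. *)
Lemma robust_pair_MIP_feasible B D r :
  admissible_slope ubar h D -> robust_pair D r ->
  (forall i j, r i 0 + slack_center r i + `|(M *m D) i j| + 1 <= B) ->
  MIP_feasible M qbar ubar h B (\col_i (r i 0 != 0)) r
    (\matrix_(i, j) (- `|D i j| * ubar j 0))
    (\matrix_(i, j) (- `|slack_slope D i j| * ubar j 0)) D.
Proof.
move=> Dadm H leB.
have sum_ge0 (a : 'I_n -> R) : 0 <= \sum_j `|a j| * ubar j 0.
  by apply: sumr_ge0 => j _; rewrite mulr_ge0 ?ubar_ge0.
have r_ge0 i : 0 <= r i 0.
  by have [+ _ _] := H i; rewrite subr_ge0; exact: le_trans.
have c_ge0 i : 0 <= slack_center r i.
  by have [_ + _] := H i; rewrite subr_ge0; exact: le_trans.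
have c_eq0 i : r i 0 != 0 -> slack_center r i = 0.
  by have [_ _ []// ->] := H i; rewrite eqxx.
have s_eq0 i j : r i 0 != 0 -> j \in idxU ubar -> slack_slope D i j = 0.
  move=> /c_eq0 c0; have [_ + _] := H i.
  by rewrite c0 sub0r => /(affine_box_ge0_center0 ubar_ge0); apply.
have r_le i : r i 0 <= B.
  by have := leB i i; have := c_ge0 i; have := normr_ge0 ((M *m D) i i); lra.
have c_le i : slack_center r i <= B.
  by have := leB i i; have := r_ge0 i; have := normr_ge0 ((M *m D) i i); lra.
have MD_le i j : - B + 1 <= (M *m D) i j <= B - 1.
  rewrite -[- B + 1]opprK opprD opprK -ler_norml.
  by have := leB i j; have := r_ge0 i; have := c_ge0 i; lra.
have off_diag i j : j \in idxU ubar -> i != j ->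
    - (B * (1 - (r i 0 != 0)%:R)) <= (M *m D) i j <= B * (1 - (r i 0 != 0)%:R).
  move=> jU ij; case: (boolP (r i 0 != 0)) => [ri | _] /=.
    have := s_eq0 i j ri jU; rewrite /slack_slope (negPf ij) addr0 => ->.
    by rewrite subrr mulr0 oppr0 lexx.
  by rewrite subr0 mulr1; have /andP[? ?] := MD_le i j; lra.
split=> //.
- move=> i; rewrite mxE r_ge0 /=.
  by case: (eqVneq (r i 0) 0) => [-> | _]; rewrite ?mulr0 ?mulr1.
- move=> i; rewrite mxE -/(slack_center r i) c_ge0 /=.
  case: (boolP (r i 0 != 0)) => [/c_eq0 -> | _] /=.
    by rewrite subrr mulr0.
  by rewrite subr0 mulr1.
- move=> i j iS jU; rewrite mxE off_diag //.
  (* [idxS] and [idxU] are disjoint, so these entries are off the diagonal. *)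
  by apply: contraTneq iS => ->; move: jU; rewrite !inE => /gt_eqF ->.
- move=> j jU; rewrite mxE.
  case: (boolP (r j 0 != 0)) => [rj | _] /=.
    have := s_eq0 j j rj jU; rewrite /slack_slope eqxx => /eqP.
    by rewrite addr_eq0 => /eqP ->; rewrite subrr mulr0 oppr0 sub0r lexx.
  by rewrite subr0 mulr1; have /andP[? ?] := MD_le j j; lra.
- by move=> i j _ jU ij; rewrite mxE off_diag.
- by move=> i j _; rewrite mxE neg_norm_leN.
- by move=> i j _; rewrite mxE neg_norm_le.
- move=> i; under eq_bigr do rewrite mxE.
  by have [Hz _ _] := H i; exact: (sum_neg_norms ubar_ge0 Hz).
- by move=> i j _; rewrite mxE neg_norm_leN.
- by move=> i j _; rewrite mxE neg_norm_le.
- move=> i; under eq_bigr do rewrite mxE.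
  by have [_ Hw _] := H i; exact: (sum_neg_norms ubar_ge0 Hw).
Qed.

End LCP.

Lemma finite_upper_bound (R : realType) (I : finType) (f : I -> R) :
  exists b, forall i, f i <= b.
Proof.
exists (\sum_i `|f i|) => i; apply: le_trans (ler_norm _) _.
by rewrite (bigD1 i) //= lerDl sumr_ge0.
Qed.

Theorem theorem2 (R : realType) (n : nat) (M : 'M[R]_n) (qbar ubar : 'cV[R]_n)
    (h : nat) (h_le_n : (h <= n)%N) (ubar_ge0 : nonneg_vec ubar) :
  exists B0 : R, forall B : R, B0 <= B ->
    (forall (x : 'cV[bool]_n) (r : 'cV[R]_n) (A C D : 'M[R]_n),
        MIP_feasible M qbar ubar h B x r A C D ->
        AAR_solution M qbar ubar h (fun u => D *m u + r)) /\
    (~ (exists (x : 'cV[bool]_n) (r : 'cV[R]_n) (A C D : 'M[R]_n),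
          MIP_feasible M qbar ubar h B x r A C D) ->
     ~ (exists z : 'cV[R]_n -> 'cV[R]_n, AAR_solution M qbar ubar h z)).
Proof.
have sound (B : R) x r (A C D : 'M[R]_n) :
    MIP_feasible M qbar ubar h B x r A C D ->
    AAR_solution M qbar ubar h (fun u => D *m u + r).
  move=> feas; exists D, r; split=> //; first exact: mip_slope feas.
  apply/(robust_complementary _ _ ubar_ge0).
  exact: MIP_feasible_robust_pair feas.
(* [B0] is read off an AAR solution, so existence is decided classically first; without one, the
   second claim is immediate and 0 serves. *)
have [[z [D [r [zE Dadm Hz]]]] | noAAR] :=
  pselect (exists z, AAR_solution M qbar ubar h z); last first.
  by exists 0 => B _; split=> [|_ //]; exact: sound.
have pairDr : robust_pair M qbar ubar D r.
  by apply/(robust_complementary _ _ ubar_ge0) => u /Hz; rewrite zE.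
have [B0 leB0] := finite_upper_bound (fun p : 'I_n * 'I_n =>
  r p.1 0 + slack_center M qbar r p.1 + `|(M *m D) p.1 p.2| + 1).
exists B0 => B leB; split; first exact: sound.
move=> infeas _; apply: infeas; do 5 eexists.
apply: (robust_pair_MIP_feasible ubar_ge0 Dadm pairDr) => i j.
exact: le_trans (leB0 (i, j)) leB.
Qed.
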